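(* Let $P$ be a bi-bounded complete, continuous poset with a $\ll_d$-increasing $\ll$-limit point $y_0$, witnessed by the sequence $(y_i)_{i\in\mathbb{N}}$, and let $X$ be a $T_1$ topological space. Then $X$ is semi-stratifiable if and only if there exists an operator $\Phi$ assigning to each map $g:X\to P$ with upper bound $y_0$ a lower semi-continuous map $\Phi(g):X\to P$ such that (a) $g\leq\Phi(g)$; (b) $\Phi(g)$ is upper bounded at each $x\in U_g$, that is, for each $x\in U_g$ there is $n\in\mathbb{N}$ with $\Phi(g)(x)\leq y_n$; and (c) $\Phi(g)\leq\Phi(g')$ whenever $g\leq g'$ (for all $g,g'$ in the domain of $\Phi$).
   Context: $\mathbb{N}=\{1,2,3,\dots\}$. Maps into $P$ are ordered pointwise: $g\le g'$ means $g(x)\le g'(x)$ for all $x$. An element $y$ is an upper bound of $g$ if $g(x)\leq y$ for all $x\in X$. Order notions. Let $(P,\leq)$ be a poset. For $x,y\in P$, $x\ll y$ ($x$ is way below $y$) if for every directed (in particular nonempty) $D\subseteq P$ having a supremum, $y\leq\bigvee D$ implies $x\leq d$ for some $d\in D$. Also $y\ll_d x$ ($x$ is way above $y$) if for every filtered (in particular nonempty) $F\subseteq P$ having an infimum, $\bigwedge F\leq y$ implies $f\leq x$ for some $f\in F$. $P$ is continuous if for every $x\in P$ the set $\{u\in P:u\ll x\}$ is directed with supremum $x$. $P$ is bi-bounded complete if every nonempty subset with a lower bound has an infimum and every nonempty subset with an upper bound has a supremum. A point $y_0\in P$ is a $\ll_d$-increasing $\ll$-limit point, witnessed by $(y_i)_{i\in\mathbb{N}}$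 in $P$, if $y_i\ll_d y_{i+1}$ and $y_i\ll y_0$ for all $i\in\mathbb{N}$, and $y_0=\bigvee_{i\in\mathbb{N}}y_i$. Lower semi-continuity. For $f:X\to P$ and $x\in X$, let $\mathcal{N}_x$ be the set of neighborhoods of $x$ and $\mathcal{N}_{x*}(f)=\{N\in\mathcal{N}_x: f(N)\text{ has an infimum}\}$. $f$ is lower semi-continuous at $x$ if $\mathcal{N}_{x*}(f)\neq\emptyset$, the set $\{\bigwedge f(N):N\in\mathcal{N}_{x*}(f)\}$ has a supremum, and this supremum equals $f(x)$. $f$ is lower semi-continuous if it is so at every $x\in X$. Local boundedness. $g:X\to P$ is locally upper bounded about $(y_i)_{i\in\mathbb{N}}$ at $x$ if there are $n\in\mathbb{N}$ and a neighborhood $O_x$ of $x$ with $g(x')\leq y_n$ for all $x'\in O_x$. $U_g=\{x\in X: g\text{ is locally upper bounded about }(y_i)_{i\in\mathbb{N}}\text{ at }x\}$. $X$ is semi-stratifiable if to each open set $U$ one can assign a sequence $(U_n)_{n\in\mathbb{N}}$ of closed sets with (1) $\bigcup_n U_n=U$; (2) if $U\subseteq V$ then $U_n\subseteq V_n$ for each $n$.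
   Formalization: Adds the hypothesis that y_i ≠ y_0 for all i; without it the claim fails: if some y_n = y_0 (e.g. P a one-point poset), the constant operator Φ(g) = y_0 satisfies (a)–(c) for every T_1 space X, semi-stratifiable or not. *)

(* Defs.v *)
From HB Require Import structures.
From mathcomp Require Import all_boot all_order.
From mathcomp Require Import all_classical topology.
Set Implicit Arguments.
Unset Strict Implicit.
Unset Printing Implicit Defensive.

Import Order.Theory.
Local Open Scope classical_set_scope.
Local Open Scope order_scope.

Section Posets.
Context {d : Order.disp_t} {P : porderType d}.
Implicit Types (D F : set P) (x y : P).

Definition directed D : Prop :=
  D !=set0 /\
  forall a b, D a -> D b -> exists2 c, D c & a <= c /\ b <= c.

Definition filtered F : Prop :=
  F !=set0 /\
  forall a b, F a -> F b -> exists2 c, F c & c <= a /\ c <= b.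

(* Suprema and infima need not exist in [P]; [supremums A s] says that [A] has
   the supremum [s], and [infimums A i] that [A] has the infimum [i]. *)

Definition way_below x y : Prop :=
  forall D s, directed D -> supremums D s -> y <= s ->
    exists2 a, D a & x <= a.

(* [way_above x y] is $y \ll_d x$: the larger element comes first. *)
Definition way_above x y : Prop :=
  forall F i, filtered F -> infimums F i -> i <= y ->
    exists2 a, F a & a <= x.

Definition incr_limit_point (y0 : P) (y : nat -> P) : Prop :=
  [/\ forall i, way_above (y i.+1) (y i),
      forall i, way_below (y i) y0 &
      supremums (range y) y0].

End Posets.

Definition continuous_poset d (P : porderType d) : Prop :=
  forall x : P, directed [set u | way_below u x] /\
                supremums [set u | way_below u x] x.

(* [has_inf A] and [has_sup A] only say that [A] is nonempty and bounded below,
   respectively above. *)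
Definition bi_bounded_complete d (P : porderType d) : Prop :=
  (forall A : set P, has_inf A -> infimums A !=set0) /\
  (forall A : set P, has_sup A -> supremums A !=set0).

Section Maps.
Context {d : Order.disp_t} {P : porderType d} {X : topologicalType}.
Implicit Types (f g : X -> P) (x : X).

(* The infima of the sets [f(N)], for those neighborhoods [N] of [x] for which
   such an infimum exists. *)
Definition nbhs_infs f x : set P :=
  [set p | exists2 N, nbhs x N & infimums (f @` N) p].

Definition lsc_at f x : Prop :=
  nbhs_infs f x !=set0 /\ supremums (nbhs_infs f x) (f x).

Definition lsc f : Prop := forall x, lsc_at f x.

Definition ptwise_le f g : Prop := forall x, f x <= g x.

Definition upper_bound_of (b : P) g : Prop := forall x, g x <= b.

Definition locally_upper_bounded (y : nat -> P) g x : Prop :=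
  exists n, exists2 O, nbhs x O & forall x', O x' -> g x' <= y n.

Definition bounded_locus (y : nat -> P) g : set X :=
  [set x | locally_upper_bounded y g x].

End Maps.

Definition semi_stratifiable (X : topologicalType) : Prop :=
  exists G : set X -> nat -> set X,
    [/\ forall U n, open U -> closed (G U n),
        forall U, open U -> \bigcup_n G U n = U &
        forall U V, open U -> open V -> U `<=` V ->
          forall n, G U n `<=` G V n].

(* Main.v *)
(** From closed expansions $U_n$ of open sets, take $V_n$ to be the interior of
    $\{g \le y_n\}$ and $F_n = \bigcup_{k \le n} (V_n)_k$: these are increasing
    closed sets with union $U_g$, and $\Phi(g)$ takes the value $y_n$ on
    $F_n \setminus F_{n-1}$ and $y_0$ off $U_g$.  Conversely, for $U$ open let
    $g_U$ be the first $y_i$ on $U$ and $y_0$ elsewhere; then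
    $U_n = \{\Phi(g_U) \le y_n\}$ is closed because $\Phi(g_U)$ is lower
    semi-continuous. *)
Require Import Defs.
From mathcomp Require Import all_boot all_order.
From mathcomp Require Import all_classical topology.
Set Implicit Arguments.
Unset Strict Implicit.
Unset Printing Implicit Defensive.

Import Order.Theory.
Local Open Scope classical_set_scope.
Local Open Scope order_scope.

Section LowerSemicontinuity.
Context {d : Order.disp_t} {P : porderType d} {X : topologicalType}.
Implicit Types (f : X -> P) (x : X).

(** If [f x] is not below [p], then [p] cannot bound all the infima whose supremum is [f x]. Some
    infimum [q] over a neighborhood [N] is therefore not below [p], and [N] misses the sublevel
    set. *)
Lemma lsc_closed_sublevel f p : lsc f -> closed [set x | f x <= p].
Proof.
move=> fl; rewrite -openC openE => x /= fxp.
have [_ [_ fxmin]] := fl x.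
have [q [N xN [qN _]] qp] : exists2 q, nbhs_infs f x q & ~ q <= p.
  apply: contrapT => H; apply: fxp; apply: fxmin => q qf.
  by apply: contrapT => qp; apply: H; exists q.
apply: filterS xN => z Nz /= fzp; apply: qp; apply: le_trans fzp.
by apply: qN; exists z.
Qed.

(** Spares computing infima: by completeness, any lower bound of [f] on a neighborhood lies below an
    actual infimum there, so plain local lower bounds suffice. *)
Lemma lsc_at_local_lbounds f x : bi_bounded_complete P ->
  (exists N p, nbhs x N /\ forall z, N z -> p <= f z) ->
  (forall u, (forall N p, nbhs x N -> (forall z, N z -> p <= f z) -> p <= u) ->
    f x <= u) ->
  lsc_at f x.
Proof.
move=> [Pinf _] fbelow fxsup.
have infN N p : nbhs x N -> (forall z, N z -> p <= f z) ->
    exists2 q, nbhs_infs f x q & p <= q.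
  move=> xN pN; have lbp : lbound (f @` N) p by move=> _ [z Nz <-]; exact: pN.
  have [q qN] : infimums (f @` N) !=set0.
    apply: Pinf; split; last by exists p.
    by exists (f x), x => //; exact: nbhs_singleton.
  by exists q; [exists N | exact: qN.2].
split; first by have [N [p [xN pN]]] := fbelow; have [q] := infN N p xN pN; exists q.
split=> [q [N xN [qN _]]|u uf].
  by apply: qN; exists x => //; exact: nbhs_singleton.
apply: fxsup => N p xN pN; have [q qf pq] := infN N p xN pN.
exact: le_trans pq (uf q qf).
Qed.

End LowerSemicontinuity.

(** Test the definition on the filtered singleton of [y]. *)
Lemma way_above_le d (P : porderType d) (x y : P) : way_above x y -> y <= x.
Proof.
move=> /(_ [set y] y) [].
- by split=> [|a b -> ->]; exists y.
- by rewrite infimums1.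
- exact: lexx.
- by move=> a ->.
Qed.

Section StepFunction.
Context {d : Order.disp_t} {P : porderType d} {X : topologicalType}.
Variables (y : nat -> P) (y0 : P).
Implicit Types (F : nat -> set X) (x : X).

Definition step F x : P :=
  if pselect (exists n, `[< F n x >]) is left e then y (ex_minn e) else y0.

Variant step_spec F x : P -> Prop :=
| StepIn n of F n x & (forall m, F m x -> (n <= m)%N) : step_spec F x (y n)
| StepOut of (forall n, ~ F n x) : step_spec F x y0.

Lemma stepP F x : step_spec F x (step F x).
Proof.
rewrite /step; case: pselect => [e|Fx].
  case: ex_minnP => n /asboolP Fn nmin.
  by apply: StepIn => // m Fm; apply: nmin; apply/asboolP.
by apply: StepOut => n Fn; apply: Fx; exists n; apply/asboolP.
Qed.

Hypotheses (yS : forall i, y i <= y i.+1) (ysup : supremums (range y) y0).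

Let yle m n : (m <= n)%N -> y m <= y n.
Proof. exact: (homo_leq (@lexx _ P) le_trans yS). Qed.

Let yle0 n : y n <= y0.
Proof. by apply: ysup.1; exists n. Qed.

Lemma step_le F n x : F n x -> step F x <= y n.
Proof. by move=> Fn; case: stepP => [m _ /(_ _ Fn)/yle|/(_ n)]. Qed.

Lemma step_le0 F x : step F x <= y0.
Proof. by case: stepP. Qed.

Lemma ge0_step F x : y 0 <= step F x.
Proof. by case: stepP => [n _ _|_]; [exact: yle | exact: yle0]. Qed.

Lemma leS_step F n x : {homo F : m n / (m <= n)%N >-> m `<=` n} ->
  ~ F n x -> y n.+1 <= step F x.
Proof.
move=> Fhomo nFn; case: stepP => [m Fm _|_]; last exact: yle0.
by apply: yle; rewrite ltnNge; apply/negP => mn; apply: nFn; exact: Fhomo Fm.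
Qed.

Lemma step_anti F F' x : (forall n, F' n `<=` F n) -> step F x <= step F' x.
Proof.
move=> F'F; case: (stepP F' x) => [n F'n _|_]; last exact: step_le0.
by apply: step_le; exact: F'F.
Qed.

(** Off the closed set [F n], that is on an open set, the step function is at least [y n.+1]. These
    local bounds already reach its value at each point. *)
Lemma lsc_step F : bi_bounded_complete P -> (forall n, closed (F n)) ->
  {homo F : m n / (m <= n)%N >-> m `<=` n} -> lsc (step F).
Proof.
move=> Pcomplete Fcl Fhomo x; apply: lsc_at_local_lbounds => // [|u ub].
  by exists setT, (y 0); split=> [|z _]; [exact: filterT | exact: ge0_step].
have u0 : y 0 <= u by apply: (ub setT) => [|z _]; [exact: filterT | exact: ge0_step].
have uS n : ~ F n x -> y n.+1 <= u.
  move=> nFn; apply: (ub (~` F n)) => [|z]; last exact: leS_step.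
  by apply: open_nbhs_nbhs; split=> //; rewrite openC.
(* First index 0 is settled by the global bound [y 0]. For first index [n.+1], the point lies off
   [F n], which gives exactly [y n.+1]. Off every [F n], all the [y n] are bounds, with supremum
   [y0]. *)
case: stepP => [[|n] _ nmin|nF] //.
  by apply: uS => /nmin; rewrite ltnn.
by apply: ysup.2 => _ [[|n] _ <-] //; exact: uS.
Qed.

End StepFunction.

Section ClosedExpansion.
Context {X : topologicalType}.
Variable G : set X -> nat -> set X.
Hypotheses (Gclosed : forall U n, open U -> closed (G U n))
  (Gcup : forall U, open U -> \bigcup_n G U n = U)
  (Ghomo : forall U V, open U -> open V -> U `<=` V ->
    forall n, G U n `<=` G V n).
Implicit Types V : nat -> set X.

(** The union over [k <= n] is finite, hence closed, and makes the sets increase with [n] although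
    [G U] need not be increasing in its index. *)
Definition diag_expansion V n : set X := \bigcup_(k in `I_n.+1) G (V n) k.

Lemma closed_diag_expansion V n : open (V n) -> closed (diag_expansion V n).
Proof. by move=> Vo; apply: closed_bigcup => // k _; exact: Gclosed. Qed.

Lemma diag_expansion_sub V n : open (V n) -> diag_expansion V n `<=` V n.
Proof. by move=> Vo x [k _ Gx]; rewrite -(Gcup Vo); exists k. Qed.

Lemma diag_expansionS V V' n : open (V n) -> open (V' n) -> V n `<=` V' n ->
  diag_expansion V n `<=` diag_expansion V' n.
Proof. by move=> Vo V'o VV' x [k kn Gx]; exists k => //; exact: Ghomo Gx. Qed.

Lemma diag_expansion_homo V : (forall n, open (V n)) ->
  {homo V : m n / (m <= n)%N >-> m `<=` n} ->
  {homo diag_expansion V : m n / (m <= n)%N >-> m `<=` n}.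
Proof.
move=> Vo Vhomo m n mn x [k /= km Gx].
exists k; first exact: leq_trans km _.
by apply: Ghomo Gx => //; exact: Vhomo.
Qed.

Lemma bigcup_diag_expansion V : (forall n, open (V n)) ->
  {homo V : m n / (m <= n)%N >-> m `<=` n} ->
  \bigcup_n V n `<=` \bigcup_n diag_expansion V n.
Proof.
move=> Vo Vhomo x [n _]; rewrite -(Gcup (Vo n)) => -[k _ Gx].
(* The index must dominate both [n], to enlarge the open set, and [k], to admit the [k]-th closed
   piece. *)
exists (maxn n k) => //; exists k; first by rewrite /= ltnS leq_maxr.
by apply: Ghomo Gx => //; apply: Vhomo; exact: leq_maxl.
Qed.

End ClosedExpansion.

Theorem theorem3p2 (d : Order.disp_t) (P : porderType d) (y0 : P)
    (y : nat -> P) (X : topologicalType)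
    (Pcomplete : bi_bounded_complete P)
    (Pcontinuous : continuous_poset P)
    (ylimit : incr_limit_point y0 y)
    (yproper : forall i, y i <> y0)
    (XT1 : accessible_space X) :
  semi_stratifiable X <->
  exists Phi : (X -> P) -> (X -> P),
    [/\ forall g, upper_bound_of y0 g -> lsc (Phi g),
        forall g, upper_bound_of y0 g -> ptwise_le g (Phi g),
        forall g, upper_bound_of y0 g -> forall x, bounded_locus y g x ->
          exists n, (Phi g x <= y n)%O
      & forall g g', upper_bound_of y0 g -> upper_bound_of y0 g' ->
          ptwise_le g g' -> ptwise_le (Phi g) (Phi g')].
Proof.
have [/(fun H i => way_above_le (H i)) yS _ ysup] := ylimit.
have yle0 n : y n <= y0 by apply: ysup.1; exists n.
split=> [[G [Gcl Gcup Ghomo]]|[Phi [Phil Phige Phibnd Phihomo]]].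
  pose V (g : X -> P) n := [set x | g x <= y n]°.
  have Vo g n : open (V g n) by exact: open_interior.
  have Vhomo g : {homo V g : m n / (m <= n)%N >-> m `<=` n}.
    move=> m n mn; apply: interiorS => x /= /le_trans; apply.
    exact: (homo_leq (@lexx _ P) le_trans yS).
  pose F g := diag_expansion G (V g).
  exists (fun g => step y y0 (F g)); split=> [g gy0|g gy0 x|g gy0 x [n [N xN gN]]|g g' gy0 g'y0 gg' x].
  - apply: lsc_step => // [n|]; first exact: closed_diag_expansion.
    exact: diag_expansion_homo.
  - case: stepP => [n Fn _|_]; last exact: gy0.
    exact: (interior_subset (diag_expansion_sub Gcup (Vo g n) Fn)).
  - have [|m _ Fm] := bigcup_diag_expansion Gcup Ghomo (Vo g) (Vhomo g) (t := x).
      by exists n => //; exact: filterS xN.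
    by exists m; exact: step_le.
  (* Two reversals cancel: a larger map has smaller sublevel sets, and smaller sets give a larger
     step function. *)
  - apply: step_anti => // n; apply: diag_expansionS => //.
    by apply: interiorS => z /=; exact: le_trans.
pose gU (U : set X) x := if x \in U then y 0 else y0.
have gUy0 U : upper_bound_of y0 (gU U) by move=> x; rewrite /gU; case: ifP.
exists (fun U n => [set x | Phi (gU U) x <= y n]); split=> [U n _|U Uo|U V _ _ UV n x /=].
- exact/lsc_closed_sublevel/Phil.
- apply/seteqP; split=> [x [n _ /= Phin]|x Ux].
    (* Off [U] the map [gU U] equals [y0], so [Phi (gU U) x <= y n] would force [y n = y0], against
       [yproper]. *)
    apply: contrapT => nUx; apply: (yproper n); apply/le_anti.
    rewrite yle0 /=; apply: le_trans Phin.
    by have := Phige _ (gUy0 U) x; rewrite /gU memNset.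
  have [|n] := Phibnd _ (gUy0 U) x; last by exists n.
  exists 0%N, U; first exact: open_nbhs_nbhs.
  by move=> z /mem_set Uz; rewrite /gU Uz.
(* Enlarging [U] lowers [gU U], hence its image under [Phi], and so enlarges the sublevel sets. *)
- apply: le_trans; apply: Phihomo => // z; rewrite /gU.
  case: ifPn => [_|/negP nVz]; first by case: ifP.
  by case: ifPn => // /set_mem/UV/mem_set.
Qed.
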